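(* Let $r\ge 2$ be an integer, let $0\le p\le \frac{r-1}{r}$, and let $\mathcal F_1,\dots,\mathcal F_r\subseteq 2^{[n]}$ be $r$-cross-intersecting. Then $$\prod_{i=1}^r \mu_p(\mathcal F_i)\le p^r.$$
   Context: $[n]=\{1,\dots,n\}$ and $2^{[n]}$ is its power set. For $0\le p\le 1$ and $\mathcal F\subseteq 2^{[n]}$, the $p$-biased measure is $\mu_p(\mathcal F)=\sum_{F\in\mathcal F}p^{|F|}(1-p)^{n-|F|}$, with the convention $0^0=1$. Families $\mathcal F_1,\dots,\mathcal F_r\subseteq 2^{[n]}$ are $r$-cross-intersecting if $A_1\cap\cdots\cap A_r\neq\varnothing$ for every choice of $A_i\in\mathcal F_i$, $i\in[r]$ (vacuously true if some $\mathcal F_i$ is empty). *)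

(* Defs.v *)
From HB Require Import structures.
From mathcomp Require Import all_boot all_order all_algebra.
From mathcomp Require Import reals.

Set Implicit Arguments.
Unset Strict Implicit.
Unset Printing Implicit Defensive.

Import Order.TTheory GRing.Theory Num.Theory.

Local Open Scope ring_scope.

(* The ground set [n] is represented by 'I_n = {0, ..., n-1}. The subtraction
   n - #|A| in nat is never truncated, and x ^+ 0 = 1 also for x = 0, which is
   the convention 0^0 = 1. *)
Definition biased_measure (R : realType) (n : nat) (p : R)
    (F : {set {set 'I_n}}) : R :=
  \sum_(A in F) p ^+ #|A| * (1 - p) ^+ (n - #|A|)%N.

Definition cross_intersecting (r n : nat) (F : 'I_r -> {set {set 'I_n}}) : Prop :=
  forall A : 'I_r -> {set 'I_n},
    (forall i, A i \in F i) -> \bigcap_(i < r) A i != set0.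

(* Main.v *)
Require Import Defs.
From HB Require Import structures.
From mathcomp Require Import all_boot all_order all_algebra.
From mathcomp Require Import reals.
From mathcomp Require Import interval_inference convex exp hoelder ring lra.

Set Implicit Arguments.
Unset Strict Implicit.
Unset Printing Implicit Defensive.

Import Order.TTheory GRing.Theory Num.Theory.

Local Open Scope ring_scope.

(** Put [q = (r - 1) / r]. At [p = q], colour the ground set uniformly at random
    with [r] colours and let [A_i] be the set of points whose colour is not [i].
    Each [A_i] is [q]-biased and the [A_i] never have a common point, so a union
    bound gives [\sum_i mu_q (F i) <= r - 1], and AM-GM gives
    [\prod_i mu_q (F i) <= q ^ r]. For [0 < p <= q], write [p = q `^ s] with
    [1 <= s]. We may replace every [F i] by its up-closure, and for an up-set
    [mu_(q `^ s) F <= (mu_q F) `^ s], by induction on the coordinates and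
    convexity of [x `^ s]. Hence [\prod_i mu_p (F i) <= (q ^ r) `^ s = p ^ r]. *)

Definition upset (T : finType) (F : {set {set T}}) : Prop :=
  forall A B : {set T}, A \in F -> A \subset B -> B \in F.

Definition up_closure (T : finType) (F : {set {set T}}) : {set {set T}} :=
  [set B : {set T} | [exists A in F, A \subset B]].

Lemma upset_up_closure (T : finType) (F : {set {set T}}) : upset (up_closure F).
Proof.
move=> A B; rewrite !inE => /exists_inP[C CF sCA] sAB.
by apply/exists_inP; exists C => //; exact: subset_trans sAB.
Qed.

Lemma sub_up_closure (T : finType) (F : {set {set T}}) : F \subset up_closure F.
Proof. by apply/subsetP => A AF; rewrite inE; apply/exists_inP; exists A. Qed.

(** A common point of members of the [F i] chosen below the [A i] is also common to the [A i]. *)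
Lemma cross_intersecting_up_closure (r n : nat) (F : 'I_r -> {set {set 'I_n}}) :
  cross_intersecting F -> cross_intersecting (fun i => up_closure (F i)).
Proof.
move=> hF A hA.
have w i : exists B, (B \in F i) && (B \subset A i).
  by have := hA i; rewrite inE => /exists_inP[B BF BA]; exists B; rewrite BF.
have := hF (fun i => xchoose (w i)) (fun i => proj1 (andP (xchooseP (w i)))).
apply: contra_neq => A0; apply/eqP; rewrite -subset0 -A0; apply/subsetP => x.
move/bigcapP => hx; apply/bigcapP => i _.
by have /andP[_ /subsetP] := xchooseP (w i); apply; exact: hx.
Qed.

Section BiasedMeasure.
Variable R : realType.
Implicit Types p q s : R.

Lemma ler_biased_measure n p (F G : {set {set 'I_n}}) :
  0 <= p <= 1 -> F \subset G -> biased_measure p F <= biased_measure p G.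
Proof.
move=> /andP[p0 p1] /subsetP sFG; rewrite /biased_measure.
rewrite big_mkcond [leRHS]big_mkcond /=; apply: ler_sum => A _.
case: ifP => [/sFG -> //|_]; case: ifP => // _.
by rewrite mulr_ge0 ?exprn_ge0 ?subr_ge0.
Qed.

Lemma biased_measure_ge0 n p (F : {set {set 'I_n}}) :
  0 <= p <= 1 -> 0 <= biased_measure p F.
Proof.
move=> /andP[p0 p1]; apply: sumr_ge0 => A _.
by rewrite mulr_ge0 ?exprn_ge0 ?subr_ge0.
Qed.

Lemma biased_measure0 n (F : {set {set 'I_n}}) :
  biased_measure (0 : R) F = (set0 \in F)%:R.
Proof.
rewrite /biased_measure.
have z (A : {set 'I_n}) : A != set0 ->
    (0 : R) ^+ #|A| * (1 - 0) ^+ (n - #|A|)%N = 0.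
  by rewrite -cards_eq0 => A0; rewrite expr0n (negbTE A0) mul0r.
have [F0|F0] := boolP (set0 \in F).
  rewrite (bigD1 set0) //= big1 => [|A /andP[_ /z]//].
  by rewrite cards0 expr0 subr0 expr1n mulr1 addr0.
by rewrite big1 // => A AF; apply: z; apply: contraNneq F0 => <-.
Qed.

(* The [p]-biased measure of [F] conditioned on the coordinates outside [S]
   being those of [B]. *)
Definition fiber_measure (T : finType) p (F : {set {set T}}) (S B : {set T}) : R :=
  \sum_(A : {set T} | A \subset S)
     p ^+ #|A| * (1 - p) ^+ (#|S| - #|A|)%N * (A :|: B \in F)%:R.

Lemma fiber_measureT n p (F : {set {set 'I_n}}) :
  fiber_measure p F setT set0 = biased_measure p F.
Proof.
rewrite /fiber_measure /biased_measure [RHS]big_mkcond /=.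
under eq_bigl do rewrite subsetT.
apply: eq_bigr => A _; rewrite setU0 cardsT card_ord.
by case: (A \in F); rewrite ?mulr1 ?mulr0.
Qed.

Lemma fiber_measure_set0 (T : finType) p (F : {set {set T}}) (B : {set T}) :
  fiber_measure p F set0 B = (B \in F)%:R.
Proof.
rewrite /fiber_measure (big_pred1 set0) => [|A]; last by rewrite subset0.
by rewrite cards0 !expr0 !mul1r set0U.
Qed.

(** Conditioning on the coordinate [x]: the sets containing [x] are written [x |: A] with
    [A \subset S], and [x] then passes to the fixed part. *)
Lemma fiber_measure_setU1 (T : finType) p (F : {set {set T}}) (S B : {set T}) x :
  x \notin S ->
  fiber_measure p F (x |: S) B =
  p * fiber_measure p F S (x |: B) + (1 - p) * fiber_measure p F S B.
Proof.
move=> xS; rewrite /fiber_measure (bigID (fun A : {set T} => x \in A)) /=.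
congr (_ + _).
  rewrite (reindex_onto (fun A => x |: A) (fun A => A :\ x)) /= => [|A]; last first.
    by case/andP=> _ xA; rewrite setD1K.
  rewrite big_distrr /=; apply: eq_big => [A|A /andP[/andP[sA _] /eqP eA]].
    rewrite setU11 andbT; apply/andP/idP => [[sA /eqP eA]|sA].
      have xA : x \notin A by rewrite -eA !inE eqxx.
      apply/subsetP => y yA; have /subsetP/(_ y) := sA.
      rewrite !inE yA orbT => /(_ isT)/orP[/eqP yx|//].
      by rewrite -yx yA in xA.
    by rewrite setUS// setU1K// (contra _ xS)// => /(subsetP sA).
  have xA : x \notin A by rewrite -eA !inE eqxx.
  rewrite !cardsU1 xA xS !add1n subSS exprS -setUA (setUCA A) !mulrA.
  by rewrite setUA.
rewrite big_distrr /=; apply: eq_big => [A|A /andP[sA xA]].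
  apply/andP/idP => [[sA xA]|sA].
    apply/subsetP => y yA; have /subsetP/(_ y yA) := sA.
    by rewrite !inE => /orP[/eqP yx|//]; rewrite -yx yA in xA.
  by split; [exact: subset_trans (subsetU1 _ _)|apply: contra xS => /(subsetP sA)].
(* Thus the subtraction [#|S| - #|A|] is not truncated, and the absent point [x] contributes exactly
   one factor [1 - p]. *)
have lAS : (#|A| <= #|S|)%N.
  have := subset_leq_card (setSD [set x] sA).
  by rewrite setU1K// (setDidPl _)// disjoint_sym disjoints1.
by rewrite cardsU1 xS add1n subSn// exprS; ring.
Qed.

Lemma fiber_measure_ge0 (T : finType) p (F : {set {set T}}) (S B : {set T}) :
  0 <= p <= 1 -> 0 <= fiber_measure p F S B.
Proof.
move=> /andP[p0 p1]; apply: sumr_ge0 => A _.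
by rewrite !mulr_ge0 ?exprn_ge0 ?subr_ge0 ?ler0n.
Qed.

Lemma ler_fiber_measure (T : finType) p (F : {set {set T}}) (S B C : {set T}) :
  upset F -> 0 <= p <= 1 -> B \subset C ->
  fiber_measure p F S B <= fiber_measure p F S C.
Proof.
move=> uF /andP[p0 p1] sBC; apply: ler_sum => A _.
rewrite ler_wpM2l ?mulr_ge0 ?exprn_ge0 ?subr_ge0// ler_nat.
case: (boolP (A :|: B \in F)) => // /uF.
by move=> /(_ (A :|: C) (setUS A sBC)) ->.
Qed.

(** Both [u + d] and [v] are convex combinations of [u] and [v + d], with the weights [t] and
    [1 - t] swapped. Adding the two convexity inequalities for the power [s] gives the claim. *)
Lemma powR_increment s (u v d : R) : 1 <= s -> 0 <= u -> u <= v -> 0 <= d ->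
  (u + d) `^ s + v `^ s <= u `^ s + (v + d) `^ s.
Proof.
move=> s1 u0 uv d0.
(* For [d = 0] the denominator [v + d - u] of [t] could vanish. *)
have [->|d_neq0] := eqVneq d 0; first by rewrite !addr0.
have d_gt0 : 0 < d by rewrite lt0r d_neq0.
have w_gt0 : 0 < v + d - u by lra.
pose t := (v - u) / (v + d - u).
have t0 : 0 <= t by rewrite divr_ge0 //; lra.
have t1 : t <= 1 by rewrite ler_pdivrMr//; lra.
have tw : t * (v + d - u) = v - u by rewrite /t divfK// gt_eqF.
have conv (t' : R) (t'0 : 0 <= t') (t'1 : t' <= 1) :
    (t' * u + (1 - t') * (v + d)) `^ s <= t' * u `^ s + (1 - t') * (v + d) `^ s.
  have := @convex_powR R s s1 (Itv01 t'0 t'1) u (v + d).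
  rewrite !classical_sets.in_setE /= !in_itv /= !andbT => /(_ u0).
  by rewrite !convRE /=; apply; lra.
have := conv t t0 t1; have := conv (1 - t) ltac:(lra) ltac:(lra).
have -> : t * u + (1 - t) * (v + d) = u + d.
  by move: tw; lra.
have -> : (1 - t) * u + (1 - (1 - t)) * (v + d) = v.
  by move: tw; lra.
lra.
Qed.

(** The one-coordinate inequality: increasing increments with [u = q * b], [v = b],
    [d = q * (a - b)], after which the powers of products are split. *)
Lemma powR_two_point q s (a b : R) : 0 <= q <= 1 -> 1 <= s -> 0 <= b <= a ->
  q `^ s * a `^ s + (1 - q `^ s) * b `^ s <= (q * a + (1 - q) * b) `^ s.
Proof.
move=> /andP[q0 q1] s1 /andP[b0 ba].
have a0 : 0 <= a := le_trans b0 ba.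
have := @powR_increment s (q * b) b (q * (a - b)) s1.
have -> : q * b + q * (a - b) = q * a by ring.
have -> : b + q * (a - b) = q * a + (1 - q) * b by ring.
rewrite mulr_ge0// ler_piMl// mulr_ge0 ?subr_ge0// => /(_ isT isT isT).
rewrite !powRM //; lra.
Qed.

(* [p |-> log_p (mu_p F)] is nonincreasing for an up-set [F]. *)
Lemma fiber_measure_powR (T : finType) q s (F : {set {set T}}) (S B : {set T}) :
  upset F -> 0 <= q <= 1 -> 1 <= s ->
  fiber_measure (q `^ s) F S B <= fiber_measure q F S B `^ s.
Proof.
move=> uF q01 s1; have s0 : 0 <= s := le_trans ler01 s1.
have qs0 : 0 <= q `^ s := powR_ge0 q s.
have qs1 : q `^ s <= 1.
  have /andP[q0 q1] := q01.
  by have := ge0_ler_powR s0 q0 ler01 q1; rewrite powR1.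
(* [B] stays general, since a coordinate removed from [S] may join it. *)
elim: {S}#|S| {-2}S (erefl #|S|) B => [|m IH] S cS B.
  move/eqP: cS; rewrite cards_eq0 => /eqP ->; rewrite !fiber_measure_set0.
  by case: (B \in F); rewrite ?powR1// powR0// gt_eqF// (lt_le_trans ltr01).
have /card_gt0P[x xS] : (0 < #|S|)%N by rewrite cS.
have xS' : x \notin S :\ x by rewrite !inE eqxx.
have cS' : #|S :\ x| = m by move: cS; rewrite (cardsD1 x) xS => -[].
rewrite -(setD1K xS) !fiber_measure_setU1//.
(* Here [a] and [b] are the fiber measures with [x] present and absent; [b <= a] because [F] is an
   up-set. *)
apply: le_trans (powR_two_point q01 s1 _); last first.
  by rewrite fiber_measure_ge0// ler_fiber_measure// subsetU1.
by rewrite lerD// ler_wpM2l ?subr_ge0 ?IH.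
Qed.

Lemma biased_measure_powR n q s (F : {set {set 'I_n}}) :
  upset F -> 0 <= q <= 1 -> 1 <= s ->
  biased_measure (q `^ s) F <= biased_measure q F `^ s.
Proof. by rewrite -!fiber_measureT; exact: fiber_measure_powR. Qed.

Lemma prod_powR (I : Type) (l : seq I) (E : I -> R) s :
  (forall i, 0 <= E i) -> \prod_(i <- l) E i `^ s = (\prod_(i <- l) E i) `^ s.
Proof.
move=> E0; elim: l => [|i l IH]; first by rewrite !big_nil powR1.
by rewrite !big_cons IH powRM ?prodr_ge0.
Qed.

(* Exactly [(r - 1) ^ |A|] of the [r ^ n] colourings avoid colour [i] precisely
   on [A]. *)
Lemma biased_measure_colouring (r n : nat) (i : 'I_r) (F : {set {set 'I_n}}) :
  biased_measure ((r%:R - 1) / r%:R) F * (r ^ n)%:R =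
  #|[set c : {ffun 'I_n -> 'I_r} | [set x | c x != i] \in F]|%:R :> R.
Proof.
have r0 : (0 < r)%N := leq_ltn_trans (leq0n i) (ltn_ord i).
have rR : r%:R != 0 :> R by rewrite pnatr_eq0 -lt0n.
pose avoided (c : {ffun 'I_n -> 'I_r}) := [set x | c x != i].
rewrite -sum1_card (partition_big avoided [in F]) /=; last by move=> c; rewrite inE.
rewrite natr_sum /biased_measure mulr_suml; apply: eq_bigr => A AF.
have lA : (#|A| <= n)%N by rewrite -[X in (_ <= X)%N]card_ord max_card.
have -> : (1 - (r%:R - 1) / r%:R : R) = r%:R^-1 by field.
(* Each point of [A] turns its weight into [r - 1], and each other point turns its weight [1 / r]
   into 1. *)
have -> : (r ^ n)%:R = r%:R ^+ #|A| * r%:R ^+ (n - #|A|) :> R.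
  by rewrite natrX -exprD subnKC.
rewrite mulrACA -!exprMn divfK// mulVf// expr1n mulr1.
rewrite sum1_card -(natrB _ r0) -natrX; congr _%:R.
(* The colourings avoiding [i] precisely on [A] form a product: any of the [r - 1] other colours on
   [A], only [i] elsewhere. *)
pose avoid := family (fun x : 'I_n => if x \in A then predC1 i else pred1 i).
rewrite -(@eq_card _ avoid) => [|c].
  rewrite card_family foldrE big_image /= (bigID [in A]) /=.
  rewrite (eq_bigr (fun=> r.-1)) => [|x ->]; last by rewrite cardC1 card_ord.
  rewrite [X in (_ * X)%N]big1 => [|x /negbTE ->]; last by rewrite card1.
  by rewrite muln1 prod_nat_const subn1.
rewrite [RHS]unfold_in /= inE /avoided; apply/familyP/andP => [h|[_ /eqP <-] x].
  suff eA : [set x | c x != i] = A by rewrite inE eA; split.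
  by apply/setP => x; rewrite inE; have := h x; case: ifP; rewrite !inE // => _ ->.
by rewrite inE; case: ifP; rewrite !inE // => /negbFE.
Qed.

(** Double counting of the pairs of a colour [i] and a colouring whose set of points not coloured
    [i] lies in [F i]: each colouring occurs with at most [r - 1] colours. *)
Lemma sum_biased_measure (r n : nat) (F : 'I_r -> {set {set 'I_n}}) :
  (0 < r)%N -> cross_intersecting F ->
  \sum_(i < r) biased_measure ((r%:R - 1) / r%:R) (F i) <= r%:R - 1 :> R.
Proof.
move=> r0 hF; have rn0 : 0 < (r ^ n)%:R :> R by rewrite ltr0n expn_gt0 r0.
rewrite -(ler_pM2r rn0) mulr_suml.
rewrite (eq_bigr _ (fun i _ => biased_measure_colouring i (F i))).
rewrite -(natrB _ r0) -natrM -natr_sum ler_nat subn1.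
pose hit i (c : {ffun 'I_n -> 'I_r}) := [set x | c x != i] \in F i.
have -> : (r ^ n = \sum_(c : {ffun 'I_n -> 'I_r}) 1)%N.
  by rewrite sum1_card card_ffun !card_ord.
under eq_bigr do rewrite -sum1dep_card big_mkcond /=.
rewrite exchange_big big_distrr /=; apply: leq_sum => c _.
rewrite muln1 -big_mkcond sum1dep_card.
suff [i Fi] : exists i, ~~ hit i c.
  rewrite -[r in leqRHS]card_ord -(cardC1 i) subset_leq_card //.
  by apply/subsetP => j; rewrite !inE; apply: contraTneq => ->.
apply/existsP; rewrite -negb_forall; apply/negP => /forallP hc.
(* A common point [x] would have to avoid its own colour [c x]. *)
have /set0Pn[x /bigcapP/(_ (c x) isT)] := hF _ hc.
by rewrite inE eqxx.
Qed.

Lemma prod_biased_measure_critical (r n : nat) (F : 'I_r -> {set {set 'I_n}}) :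
  (0 < r)%N -> cross_intersecting F ->
  \prod_(i < r) biased_measure ((r%:R - 1) / r%:R) (F i)
    <= ((r%:R - 1) / r%:R) ^+ r :> R.
Proof.
move=> r0 hF; have rR : 0 < r%:R :> R by rewrite ltr0n.
have r1 : 1 <= r%:R :> R by rewrite ler1n.
set q := _ / _.
have q01 : 0 <= q <= 1.
  apply/andP; split; first by apply: divr_ge0; rewrite ?subr_ge0 ?(ltW rR).
  by rewrite ler_pdivrMr// mul1r gerBl.
have mu0 i : 0 <= biased_measure q (F i) by exact: biased_measure_ge0.
have := (leif_AGM (A := [set: 'I_r]) (fun i _ => mu0 i)).1.
under eq_bigl do rewrite inE.
under [in X in _ <= X -> _]eq_bigl do rewrite inE.
rewrite cardsT card_ord => /le_trans; apply.
rewrite lerXn2r ?nnegrE ?divr_ge0 ?sumr_ge0 ?subr_ge0//.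
by rewrite ler_pM2r ?invr_gt0// sum_biased_measure.
Qed.

End BiasedMeasure.

Theorem theorem1p2 (R : realType) (r n : nat) (hr : (2 <= r)%N) (p : R)
    (hp0 : 0 <= p) (hp1 : p <= (r%:R - 1) / r%:R)
    (F : 'I_r -> {set {set 'I_n}}) (hF : cross_intersecting F) :
  \prod_(i < r) biased_measure p (F i) <= p ^+ r.
Proof.
have r0 : (0 < r)%N := ltnW hr.
(* The value 0 is not a power of a positive [q]. At [p = 0] all the mass is on the empty set, which
   some [F i] must omit. *)
have [->|p_neq0] := eqVneq p 0.
  have [i Fi] : exists i, set0 \notin F i.
    apply/existsP; rewrite -negb_forall; apply/negP => /forallP hc.
    have /set0Pn[x /bigcapP/(_ (Ordinal r0) isT)] := hF (fun=> set0) hc.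
    by rewrite inE.
  rewrite (bigD1 i) //= biased_measure0 (negbTE Fi) mul0r.
  by rewrite exprn_ge0.
have p_gt0 : 0 < p by rewrite lt0r p_neq0.
set q : R := (r%:R - 1) / r%:R in hp1.
have q_gt0 : 0 < q := lt_le_trans p_gt0 hp1.
have q_lt1 : q < 1 by rewrite /q ltr_pdivrMr ?ltr0n// mul1r gtrBl.
have q01 : 0 <= q <= 1 by rewrite !ltW.
have p01 : 0 <= p <= 1 by rewrite hp0 (le_trans hp1 (ltW q_lt1)).
have lnq : ln q < 0 by rewrite ln_lt0// q_gt0.
pose s := ln p / ln q.
have s1 : 1 <= s by rewrite ler_ndivlMr// mul1r ler_ln.
have pE : p = q `^ s by rewrite /powR gt_eqF// divfK ?lt_eqF// lnK.
clearbody s; have s0 : 0 <= s := le_trans ler01 s1.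
pose G i := up_closure (F i).
have G0 i : 0 <= biased_measure q (G i) by exact: biased_measure_ge0.
apply: (@le_trans _ _ (\prod_(i < r) biased_measure q (G i) `^ s)).
  apply: ler_prod => i _; rewrite biased_measure_ge0//=.
  apply: le_trans (ler_biased_measure p01 (sub_up_closure (F i))) _.
  by rewrite {1}pE biased_measure_powR//; exact: upset_up_closure.
(* Exchanging the exponents [r] and [s] turns [p ^+ r] into the [s]-th power of the critical bound
   [q ^+ r]. *)
rewrite prod_powR // -(powR_mulrn r hp0) pE -powRrM mulrC powRrM.
rewrite powR_mulrn ?(ltW q_gt0)//.
apply: ge0_ler_powR => //; rewrite ?nnegrE ?prodr_ge0 ?exprn_ge0 ?(ltW q_gt0)//.
apply: prod_biased_measure_critical => //.
exact: cross_intersecting_up_closure.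
Qed.
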